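(* For any integer $k\ge 3$, there exists a graph $G_k$ such that $\Gamma_b(G_k)-\alpha_{\mathrm{bn}}(G_k)\ge\lfloor k/2\rfloor$.
   Context: All graphs are finite and simple. Let $d(u,v)$ denote distance and $e(v)$ the eccentricity of $v$. A broadcast on a connected graph $G=(V,E)$ is a function $f:V\to\{0,1,\dots,\operatorname{diam}(G)\}$ with $f(v)\le e(v)$ for all $v\in V$ if $|V|\ge 2$, and $f(v)=1$ if $V=\{v\}$. On a disconnected graph, a broadcast is a union of broadcasts on its components. Let $V_f^+=\{v: f(v)>0\}$ and $\sigma(f)=\sum_{v\in V}f(v)$ (the weight). A vertex $u$ hears $f$ from $v\in V_f^+$ (and $v$ dominates $u$) if $d(u,v)\le f(v)$. $f$ is dominating if every vertex hears $f$ from some vertex of $V_f^+$. A dominating broadcast $f$ is minimal dominating if no broadcast $g\neq f$ with $g(v)\le f(v)$ for all $v$ is dominating. $\Gamma_b(G)$ is the maximum weight of a minimal dominating broadcast of $G$. For $v\in V_f^+$ let $N_f(v)=\{u:d(u,v)\le f(v)\}$ and $B_f(v)=\{u:d(u,v)=f(v)\}$. $f$ is bn-independent if $N_f(u)\cap N_f(v)\subseteq B_f(u)\cap B_f(v)$ for all distinct $u,v\in V_f^+$. $\alpha_{\mathrm{bn}}(G)$ is the maximum weight of a bn-independent broadcast on $G$. *)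

(* Defs.v *)
From mathcomp Require Import all_boot.

Set Implicit Arguments.
Unset Strict Implicit.
Unset Printing Implicit Defensive.

Record sgraph := SGraph {
  vertex :> finType;
  adj : rel vertex;
  adj_sym : symmetric adj;
  adj_irrefl : irreflexive adj
}.

Section Distance.
Variable G : sgraph.
Implicit Types u v : G.

Definition walk n u v : bool :=
  [exists p : n.-tuple G, path (@adj G) u p && (last u p == v)].

(* Two vertices of the same component are joined by a walk of length < #|G|.
   For vertices in different components the value is the junk #|G|, so every
   use of [dist] below is guarded by [connect]. *)
Definition dist u v : nat := find (fun n => walk n u v) (iota 0 #|G|).

Definition component v : {set G} := [set u | connect (@adj G) v u].

(* Eccentricity of v in its component, and diameter of that component. *)
Definition ecc v : nat := \max_(u in component v) dist u v.
Definition diam v : nat := \max_(u in component v) ecc u.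

Lemma walk_connect n u v : walk n u v -> connect (@adj G) u v.
Proof.
by case/existsP=> p /andP[pth /eqP lst]; apply/connectP; exists p.
Qed.

Lemma dist_le n u v : walk n u v -> dist u v <= n.
Proof.
move=> w; rewrite leqNgt; apply/negP => lt.
have := before_find 0 lt; rewrite nth_iota ?w //.
by apply: leq_trans lt _; rewrite -[X in _ <= X](size_iota 0); apply: find_size.
Qed.

Lemma connect_dist u v :
  connect (@adj G) u v -> (dist u v < #|G|) && walk (dist u v) u v.
Proof.
case/connectP=> p0 pth0 ->; case/shortenP: pth0 => p pth unq _.
have szp : size p < #|G| by rewrite -[(size p).+1]/(size (u :: p)) -(card_uniqP unq) max_card.
have w : walk (size p) u (last u p).
  by apply/existsP; exists (in_tuple p); rewrite pth eqxx.
have hs : has (fun n => walk n u (last u p)) (iota 0 #|G|).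
  by apply/hasP; exists (size p); rewrite // mem_iota.
have lt : dist u (last u p) < #|G|.
  by move: hs; rewrite has_find size_iota.
by rewrite lt; have := nth_find 0 hs; rewrite nth_iota.
Qed.

End Distance.

Section Broadcasts.
Variable G : sgraph.
Implicit Types u v : G.

(* The values a broadcast may take at v; on a disconnected graph the
   constraint is that of the component of v. *)
Definition broadcast_value v (n : nat) : bool :=
  if #|component v| == 1 then n == 1 else (n <= diam v) && (n <= ecc v).

Lemma broadcast_value_bound v n : broadcast_value v n -> n < #|G|.+1.
Proof.
have gt0 : 0 < #|G| by apply/card_gt0P; exists v.
rewrite /broadcast_value; case: ifP => _; first by move/eqP->.
case/andP=> _ /leq_trans; apply; apply/bigmax_leqP => u; rewrite inE => uv.
apply: ltnW; suff /connect_dist/andP[] : connect (@adj G) u v by [].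
by rewrite (sym_connect_sym (@adj_sym G)).
Qed.

(* By [broadcast_value_bound], bounding the codomain excludes no broadcast;
   it makes the maxima below range over a finite type. *)
Definition bfun := {ffun G -> 'I_#|G|.+1}.
Implicit Types f g : bfun.

Definition broadcast f : bool := [forall v, broadcast_value v (f v)].

Definition weight f : nat := \sum_v f v.

Definition Vplus f : {set G} := [set v | 0 < f v].

Definition hears f u v : bool := (u \in component v) && (dist u v <= f v).

Definition dominating f : bool := [forall u, exists v in Vplus f, hears f u v].

Definition minimal_dominating f : bool :=
  [&& broadcast f, dominating f &
    [forall g : bfun,
       [&& broadcast g, g != f & [forall v, g v <= f v]] ==> ~~ dominating g]].

Definition Nf f v : {set G} := [set u in component v | dist u v <= f v].
Definition Bf f v : {set G} := [set u in component v | dist u v == f v].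

Definition bn_independent f : bool :=
  broadcast f &&
  [forall u in Vplus f, forall v in Vplus f,
     (u != v) ==> (Nf f u :&: Nf f v \subset Bf f u :&: Bf f v)].

End Broadcasts.

Definition Gamma_b (G : sgraph) : nat :=
  \max_(f : bfun G | minimal_dominating f) weight f.

Definition alpha_bn (G : sgraph) : nat :=
  \max_(f : bfun G | bn_independent f) weight f.

(* Main.v *)
Require Import Defs.
From mathcomp Require Import all_boot all_order all_algebra.

Set Implicit Arguments.
Unset Strict Implicit.
Unset Printing Implicit Defensive.

(** The graph is the prism over a complete graph, the Cartesian product of
    [K_k] and [K_2].

    The constant broadcast 1 on one of the two copies of [K_k] dominates, and
    it is minimal because each vertex of that copy is the only one from which
    its twin in the other copy hears ([minimal_dominating_layer]).  Hence
    [Gamma_b] is at least [k].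

    In a bn-independent broadcast, no broadcasting vertex hears another one
    ([bn_independent_unheard]): a vertex lies in its own ball but never on the
    boundary of that ball.  The prism has diameter 2, so a vertex of value at
    least 2 is heard everywhere and must be the only broadcasting vertex; if
    all values are at most 1, each of the two copies of [K_k] contains at most
    one broadcasting vertex.  Either way the weight is at most 2
    ([alpha_bn_prism]), and [k - 2 >= k./2] for [k >= 3]. *)

Lemma leq_sum_unique_pos (T : finType) (F : T -> nat) m :
    (forall i, F i <= m) -> (forall i j, 0 < F i -> 0 < F j -> i = j) ->
  \sum_i F i <= m.
Proof.
move=> le_m uniq_pos; have [[i Fi]|F0] := altP (@existsP _ (fun i => 0 < F i)).
  rewrite (bigD1 i) //= big1 ?addn0 // => j ne_ji.
  by apply/eqP; rewrite -leqn0 leqNgt; apply: contra ne_ji => Fj; apply/eqP/uniq_pos.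
rewrite big1 // => i _; apply/eqP; rewrite -leqn0 leqNgt.
by apply: contra F0 => Fi; apply/existsP; exists i.
Qed.

(** * Distances and eccentricities *)

Section Graph.
Variable G : sgraph.
Implicit Types u v w : G.

Lemma walk0 u v : walk 0 u v = (u == v).
Proof.
apply/existsP/eqP => [[p]|->]; first by rewrite tuple0 /= => /eqP.
by exists [tuple]; rewrite /= eqxx.
Qed.

Lemma walk1 u v : walk 1 u v = adj u v.
Proof.
apply/existsP/idP => [[p]|uv]; last by exists [tuple v]; rewrite /= uv eqxx.
by case/tupleP: p => w p; rewrite tuple0 /= andbT => /andP[uw /eqP <-].
Qed.

Lemma walk_cons n u v w : adj u w -> walk n w v -> walk n.+1 u v.
Proof.
move=> uw /existsP[p /andP[pth lst]].
by apply/existsP; exists [tuple of w :: p]; rewrite /= uw pth lst.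
Qed.

Lemma component_refl v : v \in component v.
Proof. by rewrite inE connect0. Qed.

Lemma component_dist u v : u \in component v -> walk (dist u v) u v.
Proof.
rewrite inE (sym_connect_sym (@adj_sym G)).
by case/connect_dist/andP.
Qed.

Lemma distxx v : dist v v = 0.
Proof. by apply/eqP; rewrite -leqn0 dist_le // walk0. Qed.

Lemma dist_le1 u v : u \in component v -> dist u v <= 1 -> (u == v) || adj u v.
Proof.
move/component_dist; case: (dist u v) => [|[|//]]; first by rewrite walk0 => ->.
by rewrite walk1 orbC => ->.
Qed.

Lemma broadcast_value1 u v : adj u v -> broadcast_value v 1.
Proof.
move=> uv; have vu : adj v u by rewrite adj_sym.
have ne_uv : u != v by apply: contraTneq uv => ->; rewrite adj_irrefl.
have uC : u \in component v by rewrite inE connect1.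
have ecc_gt0 : 0 < ecc v.
  apply: leq_trans (leq_bigmax_cond _ uC); rewrite lt0n.
  by apply: contra ne_uv => /eqP d0; have := component_dist uC; rewrite d0 walk0.
rewrite /broadcast_value; case: ifP => // _; rewrite ecc_gt0 andbT.
by apply: leq_trans ecc_gt0 _; apply: leq_bigmax_cond; apply: component_refl.
Qed.

Lemma broadcast_value0 u v : adj u v -> broadcast_value v 0.
Proof.
move=> uv; have vu : adj v u by rewrite adj_sym.
rewrite /broadcast_value ifF //; apply/negP => /cards1P[w Cw].
have: u \in component v by rewrite inE connect1.
have := component_refl v; rewrite Cw !inE => /eqP vw /eqP uw.
by move: uv; rewrite uw vw adj_irrefl.
Qed.

(** A vertex [u] with [f u > 0] is in its own ball but not on its boundary,
    so it cannot be in another ball. *)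
Lemma bn_independent_unheard (f : bfun G) u v :
    bn_independent f -> 0 < f u -> 0 < f v -> u \in component v -> u != v ->
  f v < dist u v.
Proof.
case/andP=> _ /forallP/(_ u)/implyP indep fu fv uC ne_uv.
move: indep; rewrite inE => /(_ fu)/forallP/(_ v); rewrite inE fv ne_uv /=.
move/subsetP/(_ u); rewrite !inE connect0 distxx.
rewrite inE in uC; rewrite uC /= ltnNge => sub; apply/negP => duv.
by case/andP: (sub duv); rewrite eq_sym -leqn0 leqNgt fu.
Qed.

End Graph.

(** * The prism over a complete graph *)

Section Prism.
Variable n : nat.

Definition prism_adj : rel ('I_n * bool) :=
  fun x y => (x.1 == y.1) (+) (x.2 == y.2).

Lemma prism_adj_sym : symmetric prism_adj.
Proof. by move=> x y; rewrite /prism_adj eq_sym [x.2 == _]eq_sym. Qed.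

Lemma prism_adj_irrefl : irreflexive prism_adj.
Proof. by move=> x; rewrite /prism_adj !eqxx. Qed.

Definition prism := SGraph prism_adj_sym prism_adj_irrefl.
Implicit Types (x y : prism) (i j : 'I_n) (b : bool).

Definition twin x : prism := (x.1, ~~ x.2).

Lemma adj_twin x : adj (twin x) x.
Proof. by rewrite /= /prism_adj /= eqxx; case: x.2. Qed.

Lemma adj_layer i j b : i != j -> @adj prism (i, b) (j, b).
Proof. by rewrite /= /prism_adj /= eqxx => /negPf ->. Qed.

Lemma prism_walk2 x y : exists2 m, m <= 2 & walk m x y.
Proof.
case: (eqVneq x y) => [->|ne_xy]; first by exists 0; rewrite ?walk0.
have [xy|nxy] := boolP (adj x y); first by exists 1; rewrite ?walk1.
(* Distinct non-adjacent vertices differ in both coordinates, so the twin of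
   the first one lies in the copy of the second one. *)
exists 2 => //; apply: (@walk_cons _ _ _ _ (twin x)).
  by rewrite adj_sym adj_twin.
rewrite walk1; case: x y ne_xy nxy => [i b] [j c].
rewrite xpair_eqE /= /prism_adj /=.
by case: (i == j); case: b; case: c.
Qed.

Lemma prism_component x y : x \in component y.
Proof.
by have [m _ /walk_connect yx] := prism_walk2 y x; rewrite inE.
Qed.

Lemma prism_dist_le2 x y : dist x y <= 2.
Proof. by have [m m2 /dist_le d] := prism_walk2 x y; apply: leq_trans d m2. Qed.

Lemma prism_broadcast_le2 (f : bfun prism) x : broadcast f -> f x <= 2.
Proof.
move/forallP/(_ x); rewrite /broadcast_value; case: ifP => _; first by move/eqP->.
case/andP=> _ /leq_trans; apply; apply/bigmax_leqP => y _.
exact: prism_dist_le2.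
Qed.

(** A single vertex may broadcast 2; otherwise the broadcasting vertices form
    an independent set, which meets each of the two cliques at most once. *)
Lemma alpha_bn_prism : alpha_bn prism <= 2.
Proof.
apply/bigmax_leqP => f indep; have [bf _] := andP indep.
have [[x fx]|no_big] := altP (@existsP _ (fun x : prism => 1 < f x)).
  apply: leq_sum_unique_pos => [y|y z fy fz]; first exact: prism_broadcast_le2.
  suff only_x t : 0 < f t -> t = x by rewrite (only_x y fy) (only_x z fz).
  move=> ft; apply/eqP; apply: contraT => ne_tx.
  have := bn_independent_unheard indep ft (ltnW fx) (prism_component t x) ne_tx.
  by rewrite ltnNge (leq_trans (prism_dist_le2 t x) fx).
have le1 x : f x <= 1.
  by rewrite leqNgt; apply: contra no_big => fx; apply/existsP; exists x.
have ->: weight f = \sum_b \sum_i f (i, b).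
  rewrite exchange_big pair_big; apply: eq_bigr => -[i b] _ //.
have layer b : \sum_i f (i, b) <= 1.
  apply: leq_sum_unique_pos => // i j fi fj.
  apply/eqP; apply: contraT => ne_ij.
  have ne : (i, b) != (j, b) :> prism by rewrite xpair_eqE (negPf ne_ij).
  have := bn_independent_unheard indep fi fj (prism_component _ _) ne.
  rewrite ltnNge (leq_trans _ fj) // dist_le // walk1.
  exact: adj_layer.
by rewrite big_bool; apply: (leq_add (layer true) (layer false)).
Qed.

Definition layer_broadcast : bfun prism := [ffun x : prism => inord x.2].

Lemma layer_broadcastE x : layer_broadcast x = x.2 :> nat.
Proof.
rewrite ffunE inordK //; have : 0 < #|prism| by apply/card_gt0P; exists x.
by case: x.2.
Qed.

(** Lowering the value of [x] to 0 leaves its twin undominated. *)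
Lemma minimal_dominating_layer : minimal_dominating layer_broadcast.
Proof.
apply/and3P; split.
- apply/forallP => x; rewrite layer_broadcastE.
  case: (x.2); [exact: broadcast_value1 (adj_twin x)|].
  exact: broadcast_value0 (adj_twin x).
- apply/forallP => -[i b]; apply/existsP; exists (i, true).
  rewrite inE layer_broadcastE /hears prism_component layer_broadcastE /=.
  by case: b; rewrite ?distxx // dist_le // walk1; apply: (adj_twin (i, true)).
apply/forallP => g; apply/implyP => /and3P[_ ne_g /forallP le_g].
have g_le x : g x <= x.2 by rewrite -layer_broadcastE.
have [i gi0] : exists i, g (i, true) = 0 :> nat.
  case: (altP (@existsP _ (fun i => g (i, true) == 0 :> nat))) => [[i /eqP]|].
    by exists i.
  rewrite negb_exists => /forallP g1; case/eqP: ne_g; apply/ffunP => -[i b].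
  apply: val_inj; rewrite /= layer_broadcastE /=; apply/eqP.
  rewrite eqn_leq g_le /=.
  by case: b => //=; rewrite lt0n.
apply/forallPn; exists (i, false); rewrite negb_exists; apply/forallP => -[j b].
rewrite inE; apply/negP => /andP[gj /andP[C d]].
have := g_le (j, b); case: b gj d C => [gj d C /= gj1|gj _ _]; last first.
  by rewrite leqNgt gj.
have := dist_le1 C (leq_trans d gj1).
rewrite xpair_eqE andbF /= /prism_adj /= addbF => /eqP eq_ij.
by rewrite -eq_ij gi0 in gj.
Qed.

Lemma Gamma_b_prism : n <= Gamma_b prism.
Proof.
apply: leq_trans (leq_bigmax_cond _ minimal_dominating_layer).
rewrite /weight (eq_bigr _ (fun x _ => layer_broadcastE x)).
rewrite -(pair_big xpredT xpredT (fun (_ : 'I_n) (b : bool) => nat_of_bool b)).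
by under eq_bigr do rewrite big_bool; rewrite sum1_card card_ord.
Qed.

End Prism.

Theorem proposition4p1 (k : nat) (hk : (3 <= k)%N) :
  exists G : sgraph,
    ((k %/ 2)%N%:Z <= (Gamma_b G)%:Z - (alpha_bn G)%:Z)%R.
Proof.
exists (prism k).
rewrite Num.Theory.lerBrDr -PoszD lez_nat.
apply: leq_trans (Gamma_b_prism k).
apply: leq_trans (leq_add (leqnn _) (alpha_bn_prism k)) _.
case: k hk => [|[|[|m]]] // _; rewrite divn2 addn2 /= !ltnS.
by rewrite leq_uphalf_double -addnn leq_addr.
Qed.
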